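(* Consider a set of producers $\mathcal N=\{1,\dots,n\}$, quadratic production cost functions $C_i(q)=bq+c_iq^2/2$ with $b>0$ and $c_i>0$ for every $i\in\mathcal N$, and the affine demand function $D(p)=\gamma(\hat p-p)$ with $\gamma>0$ and $\hat p>0$. For $K>0$, let $x_i^{(K)}$, $i\in\mathcal N$, and $p^*_K$ be the activation prices and, respectively, the market-clearing price of any Nash equilibrium $S^{(K)}$ of the $\mathrm{Lip}_K$-pay-as-bid auction game. Then, for every producer $i\in\mathcal N$, $$\lim_{K\to+\infty}x_i^{(K)}=\lim_{K\to+\infty}p^*_K=\frac{\hat p\gamma+b\sum_{j=1}^n1/c_j}{\gamma+\sum_{j=1}^n1/c_j}.$$ Moreover, the asymptotic quantity of good sold by a producer $i\in\mathcal N$ is $$\lim_{K\to+\infty}S_i^{(K)}(p^*_K)=\frac{\gamma/c_i}{\gamma+\sum_{j=1}^n1/c_j}[\hat p-b]_+\,,$$ while its asymptotic profit is $$\lim_{K\to+\infty}u_i(S^{(K)})=\frac{\gamma^2}{2c_i\left(\gamma+\sum_{j=1}^n1/c_j\right)^2}[\hat p-b]_+^2\,.$$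
   Context: Notation: $\mathbb R_+=[0,\infty)$, $[t]_+=\max\{t,0\}$; $\mathcal N$ is non-empty and finite. $\mathrm{Lip}_K$ is the set of non-decreasing functions $F:[0,\hat p]\to\mathbb R_+$ with $F(0)=0$ and $|F(x)-F(y)|\le K|x-y|$ for all $x,y\in[0,\hat p]$. The $\mathrm{Lip}_K$-pay-as-bid auction game is the strategic game with player set $\mathcal N$, where each player $i$ chooses a supply function $S_i\in\mathrm{Lip}_K$. Given $S=(S_1,\dots,S_n)$, the market-clearing price $p^*(S)$ is the unique $p^*\in[0,\hat p]$ with $D(p^* )=\sum_{i=1}^n S_i(p^* )$, and the utility (profit) of player $i$ is $$u_i(S)=p^*S_i(p^* )-\int_0^{p^*}S_i(p)\,dp-C_i(S_i(p^* )),\qquad p^*=p^*(S).$$ $S^*$ is a Nash equilibrium if for every $i$, $S_i^*$ maximizes $u_i(\cdot,S_{-i}^* )$ over $\mathrm{Lip}_K$. For each $K>0$ there is a unique vector $x^{(K)}\in[0,\hat p]^{\mathcal N}$ (the activation prices) such that every Nash equilibrium $S^{(K)}$ satisfies $S_i^{(K)}(p)=K[p-x_i^{(K)}]_+$ for all $p\in[0,p^*(S^{(K)})]$ and all $i\in\mathcal N$; moreover $p^*_K=p^*(S^{(K)})$.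
   Formalization: The formal theorem assumes at least two producers (the formulas fail for a single producer with b < p̂) and states the limits of the activation prices and of the market-clearing price only for b ≤ p̂ (for b > p̂ the printed limit exceeds p̂). *)

(* Defs.v *)
From HB Require Import structures.
From mathcomp Require Import all_boot all_order all_algebra.
From mathcomp Require Import all_classical all_reals all_analysis.
Set Implicit Arguments.
Unset Strict Implicit.
Unset Printing Implicit Defensive.
Import Order.TTheory GRing.Theory Num.Theory.
Import numFieldNormedType.Exports.
Local Open Scope classical_set_scope.
Local Open Scope ring_scope.

(** Supply functions are total functions [R -> R] of which only the values on
    [[0, phat]] are constrained, and only these enter the game. *)
Definition LipK {R : realType} (phat K : R) : set (R -> R) :=
  [set F | [/\ F 0 = 0,
    forall p, p \in `[0, phat] -> 0 <= F p,
    {in `[0, phat] &, {homo F : p q / p <= q}} &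
    {in `[0, phat] &, forall p q, `|F p - F q| <= K * `|p - q|}]].

(** The default value [0] is never used for a decreasing continuous demand that
    vanishes at [phat] and supplies in [LipK]: the price then exists and is
    unique. *)
Definition clearing_price {R : realType} {n : nat} (phat : R) (D : R -> R)
    (S : 'I_n -> R -> R) : R :=
  xget 0 [set p | p \in `[0, phat] /\ D p = \sum_(i < n) S i p].

Definition utility {R : realType} {n : nat} (phat : R) (D : R -> R)
    (C : 'I_n -> R -> R) (S : 'I_n -> R -> R) (i : 'I_n) : R :=
  let ps := clearing_price phat D S in
  ps * S i ps - \int[@lebesgue_measure R]_(p in `[0, ps]) S i p - C i (S i ps).

Definition deviation {R : realType} {n : nat} (S : 'I_n -> R -> R) (i : 'I_n)
    (F : R -> R) : 'I_n -> R -> R :=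
  fun j => if j == i then F else S j.

Definition nash {R : realType} {n : nat} (phat : R) (D : R -> R)
    (C : 'I_n -> R -> R) (K : R) (S : 'I_n -> R -> R) : Prop :=
  forall i, LipK phat K (S i) /\
    forall F, LipK phat K F ->
      utility phat D C (deviation S i F) i <= utility phat D C S i.

Definition activation_prices {R : realType} {n : nat} (phat : R) (D : R -> R)
    (C : 'I_n -> R -> R) (K : R) (x : 'I_n -> R) : Prop :=
  (forall i, x i \in `[0, phat]) /\
  forall S, nash phat D C K S ->
    forall i p, p \in `[0, clearing_price phat D S] ->
      S i p = K * Num.max (p - x i) 0.

Definition affine_demand {R : realType} (gamma phat : R) (p : R) : R :=
  gamma * (phat - p).

Definition quadratic_cost {R : realType} {n : nat} (b : R) (c : 'I_n -> R)
    (i : 'I_n) (q : R) : R :=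
  b * q + c i * q ^+ 2 / 2.

(* Main.v *)
Require Import Defs.
From HB Require Import structures.
From mathcomp Require Import all_boot all_order all_algebra.
From mathcomp Require Import all_classical all_reals all_analysis.
From mathcomp Require Import lra ring.
Set Implicit Arguments.
Unset Strict Implicit.
Unset Printing Implicit Defensive.
Import Order.TTheory GRing.Theory Num.Theory.
Import numFieldNormedType.Exports.
Local Open Scope classical_set_scope.
Local Open Scope ring_scope.

(** Write [q_i] for the quantity sold by [i] at the clearing price [p], and
    [m = p - b] for the unit margin.  The limit is the competitive outcome, in
    which price equals every marginal cost: [c_i q_i = m] for all [i], together
    with [\sum_i q_i = gamma (phat - p)].

    The exact shape of an equilibrium is not needed.  All that is used is that no
    player gains by deviating to a ramp [y |-> K [y - x]_+].  A ramp that reaches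
    the quantity [r] has slope [K], so the integral subtracted from the revenue of
    its owner is at most [r^2/K]: for large [K], player [i] can sell any [r] at any
    price [p'] at which [r] is the residual demand, earning [p' r - C_i r] up to an
    [O(1/K)] error ([nash_ramp_deviation]).  Conversely the equilibrium profit is at
    most [p q_i - C_i q_i].  Comparing the two yields three estimates.

    - Selling less does not lower the price, so asymptotically
      [c_i q_i <= max(m, 0)] ([near_marginal_cost_le]).
    - If some rival [j] sells a quantity bounded away from 0, then [i] can sell
      slightly more at a price that is only [O(1/K)] lower, because [S_j] itself
      has integral at most [q_j^2/K] and so must drop steeply just below the
      clearing price ([nash_supply_below]).  Hence asymptotically
      [m <= c_i q_i] ([near_margin_le]).
    - If [b < phat], then [p] stays away from [phat], as otherwise a player could
      profitably sell a small quantity ([near_price_lt_choke]).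

    When [b < phat], the last estimate gives one seller of a quantity bounded away
    from 0; the second one turns it into at least two, as there are at least two
    players; the second one then applies to every player, and
    [c_i q_i - m] tends to 0.  Summing [q_i] over the players identifies the limit
    of [m], and all the other limits follow.  When [phat <= b] nobody sells
    anything, for any [K] ([no_trade]). *)

(** * Continuity and integrals of supply functions *)

Lemma lipschitz_within_continuous {R : realType} (a b L : R) (f : R -> R) :
  0 <= L -> {in `[a, b] &, forall p q, `|f p - f q| <= L * `|p - q|} ->
  {within `[a, b], continuous f}.
Proof.
move=> L0 fL; apply/subspace_continuousP => x /= xab.
apply/cvgrPdist_le => e e0; near=> y.
have yab : y \in `[a, b] by near: y; exact: withinT.
have xy : `|x - y| <= e / (L + 1).
  near: y; apply: cvg_within.
  have := @cvgr_dist_le _ _ _ (nbhs x) _ id x cvg_id; apply.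
  by rewrite divr_gt0// ltr_wpDl.
apply: le_trans (fL _ _ xab yab) _.
move: xy; rewrite ler_pdivlMr ?ltr_wpDl// => /(le_trans _); apply.
by rewrite mulrC ler_wpM2l// lerDl.
Unshelve. all: by end_near. Qed.

Lemma ramp_LipK {R : realType} (phat K x : R) : 0 < K -> 0 <= x ->
  LipK phat K (fun p => K * Num.max (p - x) 0).
Proof.
move=> K0 x0; split.
- by rewrite max_r ?mulr0// sub0r oppr_le0.
- by move=> p _; rewrite mulr_ge0 ?(ltW K0)// le_max lexx orbT.
- move=> p q _ _ pq; rewrite ler_pM2l//.
  by rewrite ge_max !le_max lexx orbT lerB.
- move=> p q _ _; rewrite -mulrBr normrM (gtr0_norm K0) ler_pM2l//.
  rewrite !maxEle ler_norml.
  have := ler_norm (p - q); have := ler_norm (q - p); rewrite distrC.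
  by case: (leP (p - x)); case: (leP (q - x)) => *; lra.
Qed.

(** The integral of a monotone function, split at [p]: the lower bound drops the
    part below [p], and each part is bounded above by its right end value. *)
Lemma monotone_integral_bounds {R : realType} (a p : R) (f : R -> R) :
  {within `[0, a], continuous f} -> p \in `[0, a] ->
  {in `[0, a] &, {homo f : x y / x <= y}} ->
  0 <= f 0 ->
  f p * (a - p) <= \int[@lebesgue_measure R]_(x in `[0, a]) f x
    <= f p * p + f a * (a - p).
Proof.
move=> fc; rewrite in_itv/= => /andP[p0 pa] fm f0.
have fi : lebesgue_measure.-integrable `[0, a] (EFin \o f).
  by apply: continuous_compact_integrable => //; exact: segment_compact.
have s1 : (`[0, p] : set R) `<=` `[0, a].
  by apply: subset_itvl; rewrite bnd_simp.
have s2 : (`]p, a] : set R) `<=` `[0, a].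
  by apply: subset_itvr; rewrite bnd_simp.
have i1 : lebesgue_measure.-integrable `[0, p] (EFin \o f).
  by apply: integrableS fi => //; exact: measurable_itv.
have i2 : lebesgue_measure.-integrable `]p, a] (EFin \o f).
  by apply: integrableS fi => //; exact: measurable_itv.
have ic (I : interval R) c : [set` I] `<=` `[0, a] ->
   lebesgue_measure.-integrable [set` I] (EFin \o cst c).
  move=> IS; have /integrableS :
    lebesgue_measure.-integrable `[0, a] (EFin \o cst c); last first.
    by apply => //; exact: measurable_itv.
  apply: continuous_compact_integrable => //.
    exact: segment_compact.
  exact/continuous_subspaceT/cst_continuous.
have m1 : fine (@lebesgue_measure R `[0, p]) = p.
  rewrite lebesgue_measure_itv/= lte_fin; case: ltP => //=; rewrite ?subr0//; lra.
have m2 : fine (@lebesgue_measure R `]p, a]) = a - p.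
  rewrite lebesgue_measure_itv/= lte_fin; case: ltP => //=; rewrite ?subr0//; lra.
have := Rintegral_itvB fi; move=> /(_ p); rewrite !bnd_simp => /(_ p0 pa).
move/eqP; rewrite subr_eq => /eqP ->.
have p_in : p \in `[0, a] by rewrite in_itv/= p0.
have a_in : a \in `[0, a] by rewrite in_itv/= lexx (le_trans p0).
have o_in : 0 \in `[0, a] by rewrite in_itv/= lexx (le_trans p0).
apply/andP; split.
  rewrite -[leLHS]addr0 lerD//.
    rewrite -m2 -(@Rintegral_cst _ _ _ lebesgue_measure)//.
    apply: le_Rintegral => //; first exact: ic.
    move=> x xpa; apply: fm => //; first exact: s2.
    by move: xpa; rewrite /= in_itv/= => /andP[/ltW].
  apply: Rintegral_ge0 => x xp; apply: le_trans f0 _; apply: fm => //.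
    exact: s1.
  by move: xp; rewrite /= in_itv/= => /andP[].
rewrite [leRHS]addrC lerD//.
  rewrite -m2 -(@Rintegral_cst _ _ _ lebesgue_measure)//.
  apply: le_Rintegral => //; first exact: ic.
  move=> x xpa; apply: fm => //; first exact: s2.
  by move: xpa; rewrite /= in_itv/= => /andP[].
rewrite -{3}m1 -(@Rintegral_cst _ _ _ lebesgue_measure)//.
apply: le_Rintegral => //; first exact: ic.
move=> x xpa; apply: fm => //; first exact: s1.
by move: xpa; rewrite /= in_itv/= => /andP[].
Qed.

(** * Market clearing *)

Section Market.
Variables (R : realType) (n : nat) (gamma phat K : R).
Hypotheses (gamma_gt0 : 0 < gamma) (phat_gt0 : 0 < phat) (K_gt0 : 0 < K).
Local Notation D := (affine_demand gamma phat).
Implicit Types (S : 'I_n -> R -> R) (P : pred 'I_n).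

Lemma clearing_price_eq S p : (forall i, LipK phat K (S i)) ->
  p \in `[0, phat] -> D p = \sum_i S i p -> clearing_price phat D S = p.
Proof.
move=> SL pI Dp; apply: xget_unique => // y [yI Dy].
have S_le x z : x \in `[0, phat] -> z \in `[0, phat] -> x <= z ->
    \sum_i S i x <= \sum_i S i z.
  by move=> xI zI xz; apply: ler_sum => i _; have [_ _ + _] := SL i; apply.
move: Dp Dy; rewrite /affine_demand => Dp Dy.
case: (ltgtP y p) => // [/[dup] yp /ltW|/[dup] yp /ltW].
  move=> /(S_le _ _ yI pI); rewrite -Dp -Dy ler_pM2l//; lra.
move=> /(S_le _ _ pI yI); rewrite -Dp -Dy ler_pM2l//; lra.
Qed.

(** For [P] selecting the rivals of a player this is the residual demand of that
    player; for [P] constantly true and [q = 0] it is market clearing. *)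
Lemma residual_demand_attains S P lo hi q : (forall i, LipK phat K (S i)) ->
  0 <= lo -> lo <= hi -> hi <= phat ->
  D hi - \sum_(i | P i) S i hi <= q <= D lo - \sum_(i | P i) S i lo ->
  exists2 p, lo <= p <= hi & D p - \sum_(i | P i) S i p = q.
Proof.
move=> SL lo0 lohi hip /andP[q1 q2].
pose Z p := D p - \sum_(i | P i) S i p.
have Zc : {within `[lo, hi], continuous Z}.
  apply: (@lipschitz_within_continuous _ _ _ (gamma + \sum_(i | P i) K)).
    by rewrite addr_ge0 ?(ltW gamma_gt0)// sumr_ge0// => i _; exact: ltW.
  move=> x y; rewrite !in_itv/= => /andP[x1 x2] /andP[y1 y2].
  have -> : Z x - Z y = gamma * (y - x) + \sum_(i | P i) (S i y - S i x).
    by rewrite sumrB /Z /affine_demand; ring.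
  apply: le_trans (ler_normD _ _) _; rewrite mulrDl lerD//.
    by rewrite normrM (gtr0_norm gamma_gt0) distrC.
  apply: le_trans (ler_norm_sum _ _ _) _; rewrite mulr_suml.
  apply: ler_sum => i _; have [_ _ _ +] := SL i.
  by rewrite (distrC x); apply; rewrite in_itv/=; apply/andP; split; lra.
have [p pI Zp] : exists2 p, p \in `[lo, hi] & Z p = q.
  apply: IVT => //; rewrite ge_min le_max.
  by rewrite -/(Z hi) in q1 *; rewrite -/(Z lo) in q2 *; rewrite q1 q2 orbT.
by exists p.
Qed.

Lemma clearing_price_itv S : (forall i, LipK phat K (S i)) ->
  clearing_price phat D S \in `[0, phat] /\
  D (clearing_price phat D S) = \sum_i S i (clearing_price phat D S).
Proof.
move=> SL.
have [] := @residual_demand_attains S predT 0 phat 0 SL (lexx 0)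
  (ltW phat_gt0) (lexx _).
  rewrite /affine_demand subrr mulr0 sub0r oppr_le0 sumr_ge0/=.
    rewrite big1 ?subr0 ?mulr_ge0 ?(ltW phat_gt0) ?(ltW gamma_gt0)// => i _.
    by have [-> _ _ _] := SL i.
  move=> i _; have [_ + _ _] := SL i; apply.
  by rewrite in_itv/= lexx (ltW phat_gt0).
move=> p pI /eqP; rewrite subr_eq0 => /eqP Dp.
by rewrite (clearing_price_eq SL _ Dp).
Qed.

End Market.

(** * Consequences of the Nash property for fixed [K] *)

Section Equilibrium.
Variables (R : realType) (n : nat) (b gamma phat K : R) (c : 'I_n -> R).
Hypotheses (b_gt0 : 0 < b) (c_gt0 : forall i, 0 < c i).
Hypotheses (gamma_gt0 : 0 < gamma) (phat_gt0 : 0 < phat) (K_gt0 : 0 < K).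
Local Notation D := (affine_demand gamma phat).
Local Notation C := (quadratic_cost b c).
Variable S : 'I_n -> R -> R.
Hypothesis S_nash : nash phat D C K S.
Local Notation ps := (clearing_price phat D S).
Local Notation q i := (S i ps).

Let SL i : LipK phat K (S i). Proof. by have [] := S_nash i. Qed.

Lemma nash_price_itv : 0 <= ps <= phat.
Proof. by have [+ _] := clearing_price_itv gamma_gt0 phat_gt0 K_gt0 SL; rewrite in_itv. Qed.

Lemma nash_clearing : \sum_i q i = gamma * (phat - ps).
Proof. by have [_ <-] := clearing_price_itv gamma_gt0 phat_gt0 K_gt0 SL. Qed.

Lemma nash_supply_ge0 i p : 0 <= p <= phat -> 0 <= S i p.
Proof. by move=> pI; have [_ + _ _] := SL i; apply; rewrite in_itv. Qed.

Lemma nash_supply_le i x y : 0 <= x -> x <= y -> y <= phat -> S i x <= S i y.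
Proof.
move=> x0 xy yp; have [_ _ + _] := SL i; apply => //; rewrite in_itv/=.
  by rewrite x0 (le_trans xy).
by rewrite (le_trans x0 xy).
Qed.

Lemma nash_supply_le_line i p : 0 <= p <= phat -> S i p <= K * p.
Proof.
move=> /andP[p0 pp]; have [S0 _ _ +] := SL i.
move=> /(_ p 0); rewrite !in_itv/= p0 pp lexx (ltW phat_gt0) S0 !subr0.
by move=> /(_ isT isT); rewrite (ger0_norm p0); apply: le_trans; exact: ler_norm.
Qed.

Lemma nash_supply_le_total i p : 0 <= p <= phat ->
  S i p <= \sum_j S j p.
Proof.
move=> pI; rewrite (bigD1 i)//= lerDl sumr_ge0// => j _.
exact: nash_supply_ge0.
Qed.

(** Deviation to the ramp of slope [K] through [(p, r)], where [r] is the residual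
    demand at [p]; the market then clears at [p]. *)
Lemma nash_ramp_deviation i p : 0 <= p <= phat ->
  let r := D p - \sum_(j | j != i) S j p in
  0 <= r <= K * p -> p * r - r ^+ 2 / K - C i r <= utility phat D C S i.
Proof.
move=> /[dup] pI /andP[p0 pp] r /andP[r0 rKp].
pose x := p - r / K.
have x0 : 0 <= x by rewrite /x subr_ge0 ler_pdivrMr// mulrC.
have xp : x <= p by rewrite /x gerBl divr_ge0// ltW.
pose F y := K * Num.max (y - x) 0.
have FL : LipK phat K F by exact: ramp_LipK.
have Fp : F p = r.
  rewrite /F max_l ?subr_ge0// /x opprB addrC subrK mulrC divfK// gt_eqF//.
have Fx : F x = 0 by rewrite /F subrr maxxx mulr0.
have F0 : F 0 = 0 by case: FL.
have [_ /(_ F FL)] := S_nash i; apply: le_trans.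
have dL j : LipK phat K (deviation S i F j).
  by rewrite /deviation; case: eqP.
have dp : clearing_price phat D (deviation S i F) = p.
  apply: (clearing_price_eq gamma_gt0 dL) => //.
  rewrite (bigD1 i)//= {1}/deviation eqxx Fp /r.
  rewrite -[LHS](subrK (\sum_(j | j != i) S j p)); congr (_ + _).
  by apply: eq_bigr => j ji; rewrite /deviation (negbTE ji).
rewrite /utility dp /deviation eqxx Fp lerB// lerB//.
have pphat : {subset `[0, p] <= `[0, phat]}.
  by move=> y; rewrite !in_itv/= => /andP[-> /le_trans]; apply.
have := @monotone_integral_bounds _ p x F.
case/(_ _ _ _ _)/andP => //.
- apply: (lipschitz_within_continuous (ltW K_gt0)).
  by case: FL => _ _ _ FK y z /pphat yI /pphat zI; exact: FK.
- by rewrite in_itv/= x0.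
- by case: FL => _ _ Fm _ y z /pphat yI /pphat zI; exact: Fm.
- by rewrite F0.
move=> _ /le_trans; apply; rewrite Fx Fp mul0r add0r /x.
by rewrite le_eqVlt; apply/orP; left; apply/eqP; ring.
Qed.

Lemma nash_quantity_bounds i : 0 <= q i <= gamma * (phat - ps).
Proof.
rewrite nash_supply_ge0 ?nash_price_itv//= -nash_clearing.
exact/nash_supply_le_total/nash_price_itv.
Qed.

Lemma residual_at_clearing i : D ps - \sum_(j | j != i) S j ps = q i.
Proof.
rewrite [D ps](_ : _ = \sum_j S j ps); last by rewrite nash_clearing.
by rewrite (bigD1 i)//= addrK.
Qed.

(** Otherwise the ramp through the equilibrium point itself would be better. *)
Lemma nash_integral_le i :
  \int[@lebesgue_measure R]_(p in `[0, ps]) S i p <= q i ^+ 2 / K.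
Proof.
have := @nash_ramp_deviation i ps nash_price_itv; rewrite residual_at_clearing/=.
rewrite nash_supply_le_line ?nash_price_itv// nash_supply_ge0 ?nash_price_itv//.
move=> /(_ isT); rewrite /utility; lra.
Qed.

(** A quantitative form of the fact that equilibrium supplies rise only just below
    the clearing price. *)
Lemma nash_supply_below i p : 0 <= p <= ps -> S i p * (ps - p) <= q i ^+ 2 / K.
Proof.
move=> pI; apply: le_trans (nash_integral_le i).
have psp : {subset `[0, ps] <= `[0, phat]}.
  move=> y; rewrite !in_itv/= => /andP[-> /le_trans]; apply.
  by case/andP: nash_price_itv.
have := @monotone_integral_bounds _ ps p (S i).
case/(_ _ _ _ _)/andP => //.
- apply: (lipschitz_within_continuous (ltW K_gt0)).
  by case: (SL i) => _ _ _ FK y z /psp yI /psp zI; exact: FK.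
- by case: (SL i) => _ _ Fm _ y z /psp yI /psp zI; exact: Fm.
- by case: (SL i) => ->.
Qed.

Lemma nash_utility_le i : utility phat D C S i <= ps * q i - C i (q i).
Proof.
rewrite /utility lerB// gerBl; apply: Rintegral_ge0 => p /=.
rewrite in_itv/= => /andP[p0 pps]; apply: nash_supply_ge0.
by rewrite p0 (le_trans pps)//; case/andP: nash_price_itv.
Qed.

(** The price induced by the deviation to [r <= q i] is at least [ps]; the
    bound uses only [ps]. *)
Lemma nash_lower_quantity i r : 0 <= r <= q i ->
  ps * r - r ^+ 2 / K - C i r <= utility phat D C S i.
Proof.
move=> /andP[r0 rq]; have /andP[ps0 psp] := nash_price_itv.
have [] := @residual_demand_attains _ _ gamma phat K gamma_gt0 K_gt0 S
  (predC1 i) ps phat r SL ps0 psp (lexx _).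
  rewrite residual_at_clearing rq andbT /affine_demand subrr mulr0 sub0r.
  apply: le_trans r0; rewrite oppr_le0 sumr_ge0// => j _.
  by apply: nash_supply_ge0; rewrite ltW// lexx.
move=> p /andP[psle pp] pr.
have p0 := le_trans ps0 psle.
have := @nash_ramp_deviation i p; rewrite pr p0 pp /= r0 => /(_ isT).
have -> : r <= K * p.
  apply: le_trans rq _; apply: le_trans (_ : K * ps <= _).
    by rewrite nash_supply_le_line// nash_price_itv.
  by rewrite ler_pM2l.
move=> /(_ isT); apply: le_trans; rewrite !lerB// ler_wpM2r//.
Qed.

(** [p] is the price, at most [ps], at which selling [r >= q i] clears the market;
    [r <= K * p] makes the ramp through [(p, r)] admissible. *)
Lemma nash_raise_quantity i r : q i <= r <= gamma * phat ->
  exists2 p, 0 <= p <= ps & gamma * (phat - p) = r + \sum_(j | j != i) S j p /\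
    (r <= K * p -> p * r - r ^+ 2 / K - C i r <= utility phat D C S i).
Proof.
move=> /andP[qr rM]; have /andP[ps0 psp] := nash_price_itv.
have [] := @residual_demand_attains _ _ gamma phat K gamma_gt0 K_gt0 S
  (predC1 i) 0 ps r SL (lexx _) ps0 psp.
  rewrite residual_at_clearing qr/= [\sum_(_ | _) _]big1 /affine_demand ?subr0//.
  by move=> j _; case: (SL j).
move=> p /andP[p0 pps] pr; exists p; first by rewrite p0.
split; first by rewrite -pr -/(affine_demand _ _ _) /= subrK.
have r0 : 0 <= r by apply: le_trans qr; case/andP: (nash_quantity_bounds i).
move=> rK; have := @nash_ramp_deviation i p; rewrite p0 (le_trans pps psp) => /(_ isT).
by rewrite /= -/(\sum_(j | predC1 i j) S j p) pr r0 rK; apply.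
Qed.

End Equilibrium.

(** * Asymptotic estimates *)

Section Asymptotics.
Variables (R : realType) (n : nat) (b gamma phat : R) (c : 'I_n -> R).
Hypotheses (n_gt1 : (1 < n)%N) (b_gt0 : 0 < b) (c_gt0 : forall i, 0 < c i).
Hypotheses (gamma_gt0 : 0 < gamma) (phat_gt0 : 0 < phat).
Local Notation D := (affine_demand gamma phat).
Local Notation C := (quadratic_cost b c).
Variable S : R -> 'I_n -> R -> R.
Hypothesis S_nash : forall K, 0 < K -> nash phat D C K (S K).
Local Notation sigma := (\sum_(j < n) (c j)^-1).
Local Notation p K := (clearing_price phat D (S K)).
Local Notation q K i := (S K i (p K)).
Local Notation margin K := (p K - b).
Local Notation M := (gamma * phat).

Let M_gt0 : 0 < M. Proof. exact: mulr_gt0. Qed.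

Let sigma_ge0 : 0 <= sigma.
Proof. by apply: sumr_ge0 => i _; rewrite invr_ge0 ltW. Qed.

Let p_itv K : 0 < K -> 0 <= p K <= phat.
Proof. by move=> K0; exact: (nash_price_itv gamma_gt0 phat_gt0 K0 (S_nash K0)). Qed.

Let q_itv K i : 0 < K -> 0 <= q K i <= gamma * (phat - p K).
Proof. by move=> K0; exact: (nash_quantity_bounds gamma_gt0 phat_gt0 K0 (S_nash K0)). Qed.

Let sum_q K : 0 < K -> \sum_i q K i = gamma * (phat - p K).
Proof. by move=> K0; exact: (nash_clearing gamma_gt0 phat_gt0 K0 (S_nash K0)). Qed.

Let q_leM K i : 0 < K -> q K i <= M.
Proof.
move=> K0; have /andP[_ /le_trans] := q_itv i K0; apply.
by rewrite ler_pM2l// gerBl; case/andP: (p_itv K0).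
Qed.

Let sqr_leM K (r : R) : 0 < K -> 0 <= r <= M -> r ^+ 2 / K <= M ^+ 2 / K.
Proof.
move=> K0 /andP[r0 rM]; rewrite ler_pM2r ?invr_gt0//.
by rewrite lerXn2r// nnegrE ?(ltW M_gt0).
Qed.

Let near_inv_lt (A e : R) : 0 < e -> \forall K \near +oo, A / K < e.
Proof.
move=> e0; near=> K.
have K0 : 0 < K by near: K; exact: nbhs_pinfty_gt.
rewrite ltr_pdivrMr// mulrC -ltr_pdivrMr//.
by near: K; apply: nbhs_pinfty_gt; exact: num_real.
Unshelve. all: by end_near. Qed.

(** Otherwise selling [e / c i] less saves more than the [O(1/K)] cost of the
    ramp. *)
Lemma near_marginal_cost_le i (e : R) : 0 < e ->
  \forall K \near +oo, c i * q K i <= Num.max (margin K) 0 + e.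
Proof.
move=> e0; have ci := c_gt0 i.
have d0 : 0 < e / c i by rewrite divr_gt0.
near=> K.
have K0 : 0 < K by near: K; exact: nbhs_pinfty_gt.
rewrite leNgt; apply/negP => lt_cq.
have m0 : 0 <= Num.max (margin K) 0 by rewrite le_max lexx orbT.
have m1 : margin K <= Num.max (margin K) 0 by rewrite le_max lexx.
have /andP[q0 _] := q_itv i K0.
pose d := e / c i.
have cd : c i * d = e by rewrite /d mulrC divfK// gt_eqF.
have dq : d <= q K i by rewrite -(ler_pM2l ci) cd; lra.
have := @nash_lower_quantity _ _ b _ _ _ c gamma_gt0 phat_gt0
  K0 _ (S_nash K0) i (q K i - d).
rewrite subr_ge0 dq gerBl (ltW d0) => /(_ isT) /le_trans.
move=> /(_ _ (nash_utility_le gamma_gt0 phat_gt0 K0 (S_nash K0) i)).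
have : (q K i - d) ^+ 2 / K <= M ^+ 2 / K.
  by apply: sqr_leM => //; rewrite subr_ge0 dq/= lerBlDr ler_wpDr ?(ltW d0) ?q_leM.
have : M ^+ 2 / K < e * d / 2.
  by near: K; apply: near_inv_lt; rewrite divr_gt0// mulr_gt0.
rewrite /quadratic_cost.
have : (c i * q K i - margin K - e) * d >= 0 by rewrite mulr_ge0 ?(ltW d0)//; lra.
have -> : c i * (q K i - d) ^+ 2 = c i * q K i ^+ 2 - 2 * (c i * q K i) * d
  + (c i * d) * d by ring.
rewrite cd; move: (M ^+2 / K) ((_ - d) ^+ 2 / K) => A B.
lra.
Unshelve. all: by end_near. Qed.

(** As long as a rival [j] sells at least [h], player [i] can raise its quantity by
    some [d <= h / 2] at a price loss of order [1/K]. *)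
Lemma near_margin_le i j (h e : R) : j != i -> 0 < h -> 0 < e ->
  \forall K \near +oo, h <= q K j -> margin K <= c i * q K i + e.
Proof.
move=> ji h0 e0; have ci := c_gt0 i.
pose d := Num.min (h / 2) (e / c i).
have d0 : 0 < d by rewrite lt_min !divr_gt0.
have dh : d <= h / 2 by rewrite ge_min lexx.
have cd : c i * d <= e by rewrite mulrC -ler_pdivlMr// ge_min lexx orbT.
near=> K => hq.
have K0 : 0 < K by near: K; exact: nbhs_pinfty_gt.
rewrite leNgt; apply/negP => lt_cq.
have /andP[qi0 _] := q_itv i K0; have /andP[qj0 _] := q_itv j K0.
have /andP[ps0 psp] := p_itv K0.
have qiD : q K i + \sum_(k | k != i) q K k = gamma * (phat - p K).
  by rewrite -sum_q// [RHS](bigD1 i).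
have rest0 x : 0 <= x -> x <= p K ->
   S K j (p K) - S K j x <= \sum_(k | k != i) q K k - \sum_(k | k != i) S K k x.
  move=> x0 xp; rewrite -sumrB (bigD1 j)//= lerDl sumr_ge0// => k _.
  by rewrite subr_ge0; exact: (nash_supply_le (S_nash K0)).
have qij : q K i + q K j <= M.
  rewrite (bigD1 j ji)/= in qiD.
  have : gamma * (phat - p K) <= M by rewrite ler_pM2l// gerBl.
  rewrite -qiD; apply: le_trans; rewrite addrA lerDl sumr_ge0// => k _.
  by case/andP: (q_itv k K0).
have [] := @nash_raise_quantity _ _ b _ _ _ c gamma_gt0 phat_gt0
  K0 _ (S_nash K0) i (q K i + d).
  by rewrite lerDl (ltW d0)/=; lra.
move=> x /andP[x0 xp] [xD].
have := rest0 x x0 xp.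
have gx : 0 <= gamma * (p K - x) by rewrite mulr_ge0 ?(ltW gamma_gt0) ?subr_ge0.
move=> rx.
(* The rivals together give up at most [d] of their sales, hence so does [j]. *)
have Sjx : h / 2 <= S K j x by nra.
have := @nash_supply_below _ _ b _ _ _ c gamma_gt0 phat_gt0 K0 _ (S_nash K0) j x.
rewrite x0 xp => /(_ isT) below.
have qjM : q K j ^+ 2 / K <= M ^+ 2 / K by apply: sqr_leM; rewrite ?qj0 ?q_leM.
have px : p K - x <= (2 * M ^+ 2 / h) / K.
  have : h / 2 * (p K - x) <= M ^+ 2 / K.
    by apply: le_trans qjM; apply: le_trans below; rewrite ler_wpM2r// subr_ge0.
  rewrite -ler_pdivlMl ?divr_gt0// => /le_trans; apply.
  by rewrite le_eqVlt; apply/orP; left; apply/eqP; field; rewrite !gt_eqF.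
have rM : q K i + d <= M by lra.
have xb : (2 * M ^+ 2 / h) / K < b / 2.
  by near: K; apply: near_inv_lt; rewrite divr_gt0.
have KM : M / K < b / 2 by near: K; apply: near_inv_lt; rewrite divr_gt0.
have cq0 : 0 <= c i * q K i by rewrite mulr_ge0// ltW.
have xK : q K i + d <= K * x.
  apply: le_trans rM _; rewrite [leRHS]mulrC -ler_pdivrMr//; lra.
move=> /(_ xK) /le_trans.
move=> /(_ _ (nash_utility_le gamma_gt0 phat_gt0 K0 (S_nash K0) i)).
have r0 : 0 <= q K i + d by rewrite addr_ge0// ltW.
have : (q K i + d) ^+ 2 / K <= M ^+ 2 / K by apply: sqr_leM => //; rewrite r0.
have loss : (p K - x) * (q K i + d) <= (2 * M ^+ 2 / h) * M / K.
  by rewrite mulrAC; apply: ler_pM; rewrite ?subr_ge0.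
have : (2 * M ^+ 2 / h) * M / K < e * d / 4.
  by near: K; apply: near_inv_lt; rewrite divr_gt0// mulr_gt0.
have : M ^+ 2 / K < e * d / 4.
  by near: K; apply: near_inv_lt; rewrite divr_gt0// mulr_gt0.
rewrite /quadratic_cost; move: loss.
have : (margin K - c i * q K i - e) * d >= 0 by rewrite mulr_ge0 ?(ltW d0)//; lra.
have : c i * d * d <= e * d by rewrite ler_pM2r.
have -> : c i * (q K i + d) ^+ 2 = c i * q K i ^+ 2 + 2 * (c i * q K i) * d
  + (c i * d) * d by ring.
have -> : (p K - x) * (q K i + d) = p K * q K i + p K * d - x * (q K i + d) by ring.
move: (M ^+2 / K) ((_ + d) ^+ 2 / K) (x * (_ + d)) (2 * M ^+ 2 / h * M / K) => A B E F.
lra.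
Unshelve. all: by end_near. Qed.

(** The constant [h] makes selling [2 * gamma * h] profitable for player [0] at
    any price at least [phat - 3 * h], whereas near the choke price [phat] all sales
    are below [gamma * h]. *)
Lemma near_price_lt_choke : b < phat ->
  exists2 h, 0 < h & \forall K \near +oo, p K <= phat - h.
Proof.
move=> bp; pose i : 'I_n := Ordinal (ltnW n_gt1).
have ci := c_gt0 i.
pose g := phat - b; have g0 : 0 < g by rewrite subr_gt0.
pose w := 12 + 4 * (c i * gamma).
have cg0 : 0 < c i * gamma by exact: mulr_gt0.
have w0 : 0 < w by rewrite /w; lra.
have [h h0 hw] : exists2 h, 0 < h & h * w = g.
  by exists (g / w); rewrite ?divr_gt0// divfK// gt_eqF.
have cgh0 : 0 < c i * gamma * h by exact: mulr_gt0.
have hw' : 12 * h + 4 * (c i * gamma * h) = g by rewrite -hw /w; ring.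
have hp : 3 * h <= phat / 2.
  by move: hw' cgh0 h0 b_gt0; rewrite /g; lra.
pose s := gamma * h.
have s0 : 0 < s by exact: mulr_gt0.
exists h => //; near=> K.
have K0 : 0 < K by near: K; exact: nbhs_pinfty_gt.
rewrite leNgt; apply/negP => lt_p.
have /andP[ps0 psp] := p_itv K0.
have tot : gamma * (phat - p K) <= s by rewrite ler_pM2l//; lra.
have /andP[q0 qt] := q_itv i K0.
have qs := le_trans qt tot.
have [] := @nash_raise_quantity _ _ b _ _ _ c gamma_gt0 phat_gt0
  K0 _ (S_nash K0) i (2 * s).
  apply/andP; split; first lra.
  by rewrite /s mulrCA ler_pM2l//; lra.
move=> x /andP[x0 xp] [xD].
have xle : gamma * (phat - x) <= gamma * (3 * h).
  rewrite xD (_ : gamma * (3 * h) = 3 * s); last by rewrite /s; ring.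
  have : \sum_(j | j != i) S K j x <= \sum_i q K i.
    rewrite [leRHS](bigD1 i)//= ler_wpDl//; apply: ler_sum => k _.
    exact: (nash_supply_le (S_nash K0)).
  rewrite sum_q//; lra.
rewrite ler_pM2l// in xle.
have Kg : gamma * 2 < K by near: K; apply: nbhs_pinfty_gt; exact: num_real.
have rK : 2 * s <= K * x.
  apply: le_trans (_ : gamma * 2 * x <= _); last by rewrite ler_wpM2r// ltW.
  rewrite (_ : 2 * s = gamma * 2 * h); last by rewrite /s; ring.
  by rewrite ler_pM2l ?mulr_gt0//; lra.
move=> /(_ rK) /le_trans.
move=> /(_ _ (nash_utility_le gamma_gt0 phat_gt0 K0 (S_nash K0) i)).
have : (2 * s) ^+ 2 / K < g * s / 4.
  by near: K; apply: near_inv_lt; rewrite divr_gt0// mulr_gt0.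
rewrite /quadratic_cost.
have : (p K - b) * q K i <= g * s.
  apply: le_trans (_ : g * q K i <= _); last by rewrite ler_pM2l.
  by rewrite ler_wpM2r// lerD2r.
have : (phat - 3 * h) * s <= x * s by rewrite ler_pM2r//; lra.
have : 12 * (h * s) + 4 * (c i * s ^+ 2) = g * s.
  by rewrite -hw' /s; ring.
have : 0 < g * s by exact: mulr_gt0.
have : 0 <= c i * q K i ^+ 2 by rewrite mulr_ge0 ?sqr_ge0// ltW.
have : 0 < h * s by exact: mulr_gt0.
have : 0 < c i * s ^+ 2 by rewrite mulr_gt0// exprn_gt0.
have -> : c i * (2 * s) ^+ 2 = 4 * (c i * s ^+ 2) by ring.
have -> : g * s = phat * s - b * s by rewrite /g; ring.
move: ((2 * s) ^+ 2 / K) => A.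
lra.
Unshelve. all: by end_near. Qed.

(** The limit margin, i.e. the limit price minus [b]. *)
Let mstar := gamma * (phat - b) / (gamma + sigma).

Let gs_gt0 : 0 < gamma + sigma. Proof. exact: ltr_pwDl. Qed.

Let mstarE : gamma * (phat - b) = mstar * (gamma + sigma).
Proof. by rewrite /mstar divfK// gt_eqF. Qed.

Lemma near_margin_ge : b < phat -> \forall K \near +oo, mstar / 2 <= margin K.
Proof.
move=> bp.
have m0 : 0 < mstar by rewrite divr_gt0// mulr_gt0// subr_gt0.
have H : \forall K \near +oo, forall i,
    c i * q K i <= Num.max (margin K) 0 + mstar / 2.
  by apply: filter_forall => i; apply: near_marginal_cost_le; rewrite divr_gt0.
near=> K.
have K0 : 0 < K by near: K; exact: nbhs_pinfty_gt.
rewrite leNgt; apply/negP => lt_m.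
have cq : forall i, c i * q K i <= Num.max (margin K) 0 + mstar / 2 by near: K.
have : gamma * (phat - p K) <= sigma * (Num.max (margin K) 0 + mstar / 2).
  rewrite -sum_q// mulr_suml; apply: ler_sum => i _.
  by rewrite mulrC ler_pdivlMr// mulrC.
have : Num.max (margin K) 0 <= mstar / 2 by rewrite ge_max; lra.
move=> /(ler_wpM2l sigma_ge0).
have : gamma * margin K < gamma * (mstar / 2) by rewrite ltr_pM2l.
move: mstarE; nra.
Unshelve. all: by end_near. Qed.

(** Every player faces a rival selling a quantity bounded away from 0. *)
Lemma near_other_quantity_ge : b < phat ->
  exists2 h, 0 < h &
    \forall K \near +oo, forall i, exists2 j, j != i & h <= q K j.
Proof.
move=> bp.
have m0 : 0 < mstar by rewrite divr_gt0// mulr_gt0// subr_gt0.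
have n0 : (0 : R) < n%:R by rewrite ltr0n (ltn_trans _ n_gt1).
have [h1 h10 Hp] := near_price_lt_choke bp.
pose eta := gamma * h1 / n%:R.
have eta0 : 0 < eta by rewrite divr_gt0// mulr_gt0.
pose cs := \sum_i c i.
have cle i : c i <= cs.
  by rewrite /cs (bigD1 i)//= lerDl sumr_ge0// => j _; exact: ltW.
have cs0 : 0 < cs by apply: lt_le_trans (cle (Ordinal n_gt1)).
pose eta' := mstar / 4 / cs.
have eta'0 : 0 < eta' by rewrite divr_gt0// divr_gt0.
exists (Num.min eta eta'); first by rewrite lt_min eta0.
have H : \forall K \near +oo, forall ij : 'I_n * 'I_n, ij.2 != ij.1 ->
    eta <= q K ij.2 -> margin K <= c ij.1 * q K ij.1 + mstar / 4.
  apply: filter_forall => -[i j]; have [->|ji] := eqVneq j i.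
    by near=> K.
  have m40 : 0 < mstar / 4 by rewrite divr_gt0.
  by apply: filterS (near_margin_le ji eta0 m40) => K HK _; exact: HK.
have Hm := near_margin_ge bp.
near=> K.
have K0 : 0 < K by near: K; exact: nbhs_pinfty_gt.
have mK : mstar / 2 <= margin K by near: K.
have pK : p K <= phat - h1 by near: K.
have HK : forall ij : 'I_n * 'I_n, ij.2 != ij.1 ->
    eta <= q K ij.2 -> margin K <= c ij.1 * q K ij.1 + mstar / 4 by near: K.
(* One player sells at least the average quantity. *)
have [j0 qj0] : exists j, eta <= q K j.
  apply: contrapT => /forallNP small.
  have : \sum_i q K i < \sum_(i < n) eta.
    apply: ltr_sum; first by apply/hasP; exists (Ordinal n_gt1);
      rewrite ?mem_index_enum.
    by move=> i _; rewrite ltNge; apply/negP; exact: small.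
  rewrite sumr_const card_ord -[eta *+ n]mulr_natr /eta divfK ?gt_eqF// sum_q//.
  rewrite ltr_pM2l//.
  lra.
(* Facing [j0], all the other players sell as well. *)
have others i : i != j0 -> eta' <= q K i.
  move=> ij; have /= := HK (i, j0); rewrite eq_sym => /(_ ij qj0) le_m.
  rewrite /eta' ler_pdivrMr//.
  have : c i * q K i <= q K i * cs.
    by rewrite mulrC ler_wpM2l//; case/andP: (q_itv i K0).
  lra.
move=> i; have [->|ij] := eqVneq i j0; last first.
  by exists j0; rewrite 1?eq_sym// ge_min qj0.
have [k kj] : exists k : 'I_n, k != j0.
  have [j00|j00] := eqVneq (Ordinal (ltnW n_gt1)) j0; last by eexists; exact: j00.
  by exists (Ordinal n_gt1); rewrite -j00.
by exists k; rewrite // ge_min others// orbT.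
Unshelve. all: by end_near. Qed.

Lemma near_marginal_cost_dist (e : R) : b < phat -> 0 < e ->
  \forall K \near +oo, forall i, `|c i * q K i - margin K| <= e.
Proof.
move=> bp e0.
have m0 : 0 < mstar by rewrite divr_gt0// mulr_gt0// subr_gt0.
have [h h0 Hh] := near_other_quantity_ge bp.
have Hm := near_margin_ge bp.
have H1 : \forall K \near +oo, forall i, c i * q K i <= Num.max (margin K) 0 + e.
  by apply: filter_forall => i; exact: near_marginal_cost_le.
have H2 : \forall K \near +oo, forall ij : 'I_n * 'I_n, ij.2 != ij.1 ->
    h <= q K ij.2 -> margin K <= c ij.1 * q K ij.1 + e.
  apply: filter_forall => -[i j]; have [->|ji] := eqVneq j i.
    by near=> K.
  by apply: filterS (near_margin_le ji h0 e0) => K HK _; exact: HK.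
near=> K => i.
have mK : mstar / 2 <= margin K by near: K.
have Kh : forall i, exists2 j, j != i & h <= q K j by near: K.
have K1 : forall i, c i * q K i <= Num.max (margin K) 0 + e by near: K.
have K2 : forall ij : 'I_n * 'I_n, ij.2 != ij.1 ->
    h <= q K ij.2 -> margin K <= c ij.1 * q K ij.1 + e by near: K.
have [j ji hj] := Kh i.
have /= := K2 (i, j) ji hj; have := K1 i.
rewrite max_l; last lra.
by rewrite ler_norml => *; apply/andP; split; lra.
Unshelve. all: by end_near. Qed.

(** * Limits *)

Lemma margin_cvg : b < phat -> margin K @[K --> +oo] --> mstar.
Proof.
move=> bp; apply/cvgrPdist_le => e e0.
have H := near_marginal_cost_dist bp e0.
near=> K.
have K0 : 0 < K by near: K; exact: nbhs_pinfty_gt.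
have cq : forall i, `|c i * q K i - margin K| <= e by near: K.
have : `|\sum_i q K i - sigma * margin K| <= sigma * e.
  rewrite !mulr_suml -sumrB; apply: le_trans (ler_norm_sum _ _ _) _.
  apply: ler_sum => i _.
  rewrite -{1}[q K i](mulKf (lt0r_neq0 (c_gt0 i))) -mulrBr normrM.
  by rewrite gtr0_norm ?invr_gt0// ler_pM2l ?invr_gt0.
rewrite sum_q// => le_e.
rewrite -(ler_pM2r gs_gt0) -(gtr0_norm gs_gt0) -normrM mulrBl -mstarE (gtr0_norm gs_gt0).
rewrite (_ : _ - _ = gamma * (phat - p K) - sigma * margin K); last by ring.
by apply: le_trans le_e _; rewrite mulrC ler_wpM2l ?(ltW e0)// lerDr ltW.
Unshelve. all: by end_near. Qed.

Lemma price_cvg : b < phat -> p K @[K --> +oo] --> b + mstar.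
Proof.
move=> bp; rewrite (_ : (fun K => p K) = (fun K => b + margin K)).
  by apply: cvgD; [exact: cvg_cst|exact: margin_cvg].
by apply/funext => K; rewrite addrC subrK.
Qed.

Lemma quantity_cvg i : b < phat -> q K i @[K --> +oo] --> mstar / c i.
Proof.
move=> bp.
have ci := lt0r_neq0 (c_gt0 i).
have d0 : (c i * q K i - margin K) @[K --> +oo] --> (0 : R).
  apply/cvgrPdist_le => e e0; apply: filterS (near_marginal_cost_dist bp e0).
  by move=> K /(_ i); rewrite sub0r normrN.
rewrite (_ : (fun K => q K i) =
             (fun K => ((c i * q K i - margin K) + margin K) / c i)).
  rewrite -[mstar]add0r; apply: cvgMr_tmp; apply: cvgD => //; exact: margin_cvg.
by apply/funext => K; rewrite subrK mulrC mulKf.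
Qed.

Lemma utility_cvg i : b < phat ->
  utility phat D C (S K) i @[K --> +oo] --> mstar ^+ 2 / (2 * c i).
Proof.
move=> bp.
have ci := lt0r_neq0 (c_gt0 i).
(* [v] is the profit without the integral term, which vanishes in the limit. *)
pose v K := margin K * q K i - c i / 2 * (q K i * q K i).
have vE K : v K = p K * q K i - C i (q K i) by rewrite /v /quadratic_cost; field.
have vl : v K @[K --> +oo] --> mstar ^+ 2 / (2 * c i).
  rewrite (_ : _ / _ = mstar * (mstar / c i) - c i / 2 * (mstar / c i * (mstar / c i))).
    apply: cvgB; first by apply: cvgM; [exact: margin_cvg|exact: quantity_cvg].
    apply: cvgM; first exact: cvg_cst.
    by apply: cvgM; exact: quantity_cvg.
  by field.
have d0 : (v K - utility phat D C (S K) i) @[K --> +oo] --> (0 : R).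
  apply/cvgrPdist_le => e e0; near=> K.
  have K0 : 0 < K by near: K; exact: nbhs_pinfty_gt.
  have := @nash_lower_quantity _ _ b _ _ _ c gamma_gt0 phat_gt0
  K0 _ (S_nash K0) i (q K i).
  have /andP[qi0 _] := q_itv i K0.
  rewrite qi0 lexx => /(_ isT).
  have := nash_utility_le gamma_gt0 phat_gt0 K0 (S_nash K0) i.
  rewrite -vE => up lo.
  have : q K i ^+ 2 / K <= M ^+ 2 / K by apply: sqr_leM; rewrite ?qi0 ?q_leM.
  have : M ^+ 2 / K < e by near: K; exact: near_inv_lt.
  rewrite sub0r normrN ger0_norm ?subr_ge0//.
  move: (vE K) lo; lra.
rewrite (_ : (fun K => utility phat D C (S K) i) =
             (fun K => v K - (v K - utility phat D C (S K) i))).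
  by rewrite -[X in _ --> X]subr0; apply: cvgB.
by apply/funext => K; rewrite opprB addrC subrK.
Unshelve. all: by end_near. Qed.

(** Sellers have [q = K * (p - x)] with [q] bounded, so [x] and the price have the
    same limit. *)
Lemma activation_cvg (x : R -> 'I_n -> R) i : b < phat ->
  (forall K, 0 < K -> activation_prices phat D C K (x K)) ->
  x K i @[K --> +oo] --> b + mstar.
Proof.
move=> bp xA.
have m0 : 0 < mstar by rewrite divr_gt0// mulr_gt0// subr_gt0.
have d0 : (p K - x K i) @[K --> +oo] --> (0 : R).
  apply/cvgrPdist_le => e e0.
  have Hq : \forall K \near +oo, 0 < q K i.
    have := @quantity_cvg i bp; move=> /cvgr_gt; apply.
    by rewrite divr_gt0.
  near=> K.
  have K0 : 0 < K by near: K; exact: nbhs_pinfty_gt.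
  have q0 : 0 < q K i by near: K.
  have [_ /(_ _ (S_nash K0) i (p K))] := xA K K0.
  have /andP[p0 _] := p_itv K0.
  rewrite in_itv/= p0 lexx => /(_ isT) qE.
  have d0 : 0 < p K - x K i.
    by move: q0; rewrite qE pmulr_rgt0// lt_max ltxx orbF.
  rewrite max_l ?(ltW d0)// in qE.
  rewrite sub0r normrN gtr0_norm// -(ler_pM2l K0) -qE mulrC -ler_pdivrMr//.
  apply: le_trans (_ : M / K <= _).
    by rewrite ler_pM2r ?invr_gt0// q_leM.
  by apply: ltW; near: K; exact: near_inv_lt.
rewrite (_ : (fun K => x K i) = (fun K => p K - (p K - x K i))).
  by rewrite -[b + mstar]subr0; apply: cvgB => //; exact: price_cvg.
by apply/funext => K; rewrite opprB addrC subrK.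
Unshelve. all: by end_near. Qed.

(** Offering nothing yields 0, and selling at a price at most [b] loses money. *)
Lemma no_trade K i : phat <= b -> 0 < K ->
  q K i = 0 /\ utility phat D C (S K) i = 0.
Proof.
move=> pb K0.
have /andP[p0 pp] := p_itv K0; have /andP[qi0 _] := q_itv i K0.
have := @nash_lower_quantity _ _ b _ _ _ c gamma_gt0 phat_gt0 K0 _ (S_nash K0) i 0.
rewrite lexx qi0 => /(_ isT).
have := nash_utility_le gamma_gt0 phat_gt0 K0 (S_nash K0) i.
rewrite /quadratic_cost !(expr0n, mulr0, mul0r, addr0, subr0)/=.
have mq : 0 <= (b - p K) * q K i by rewrite mulr_ge0// subr_ge0 (le_trans pp).
have cq : 0 <= c i * q K i ^+ 2 by rewrite mulr_ge0 ?sqr_ge0// ltW.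
move=> up lo.
have /eqP : c i * q K i ^+ 2 = 0 by lra.
rewrite mulf_eq0 gt_eqF//= sqrf_eq0 => /eqP q0; split=> //.
by apply/eqP; rewrite eq_le lo andbT; move: up; rewrite q0; lra.
Qed.

Lemma no_trade_price K : phat <= b -> 0 < K -> p K = phat.
Proof.
move=> pb K0; have /eqP := sum_q K0.
rewrite big1; last by move=> i _; have [] := no_trade i pb K0.
by rewrite eq_sym mulf_eq0 gt_eqF//= subr_eq0 => /eqP.
Qed.

Lemma no_trade_activation K (x : 'I_n -> R) i : phat <= b -> 0 < K ->
  activation_prices phat D C K x -> x i = phat.
Proof.
move=> pb K0 [/(_ i) + /(_ _ (S_nash K0) i (p K))].
have /andP[p0 _] := p_itv K0.
rewrite !in_itv/= p0 lexx => /andP[_ xp] /(_ isT).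
have [-> _] := no_trade i pb K0; rewrite no_trade_price// => /esym/eqP.
rewrite mulf_eq0 gt_eqF//= => /eqP mx0; apply/eqP; rewrite eq_le xp/=.
by rewrite -subr_le0 -mx0 le_max lexx.
Qed.

End Asymptotics.

Theorem proposition11 (R : realType) (n : nat) (b gamma phat : R)
    (c : 'I_n -> R) (S : R -> 'I_n -> R -> R)
    (n_gt1 : (1 < n)%N) (b_gt0 : 0 < b) (c_gt0 : forall i, 0 < c i)
    (gamma_gt0 : 0 < gamma) (phat_gt0 : 0 < phat)
    (S_nash : forall K, 0 < K ->
      nash phat (affine_demand gamma phat) (quadratic_cost b c) K (S K)) :
  let D := affine_demand gamma phat in
  let C := quadratic_cost b c in
  let sigma := \sum_(j < n) (c j)^-1 in
  let pK := fun K => clearing_price phat D (S K) in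
  let plim := (phat * gamma + b * sigma) / (gamma + sigma) in
  [/\ b <= phat ->
        (forall x : R -> 'I_n -> R,
           (forall K, 0 < K -> activation_prices phat D C K (x K)) ->
           forall i, x K i @[K --> +oo] --> plim) /\
        pK K @[K --> +oo] --> plim,
      forall i, S K i (pK K) @[K --> +oo] -->
        (gamma / c i) / (gamma + sigma) * Num.max (phat - b) 0 &
      forall i, utility phat D C (S K) i @[K --> +oo] -->
        gamma ^+ 2 / (2 * c i * (gamma + sigma) ^+ 2)
          * Num.max (phat - b) 0 ^+ 2].
Proof.
move=> D C sigma pK plim.
have sigma_ge0 : 0 <= sigma.
  by apply: sumr_ge0 => i _; rewrite invr_ge0 ltW.
have gs_neq0 : gamma + sigma != 0 by rewrite gt_eqF// ltr_pwDl.
have c_neq0 i : c i != 0 by rewrite gt_eqF.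
have [bp|pb] := ltP b phat.
  have plimE : plim = b + gamma * (phat - b) / (gamma + sigma).
    by rewrite /plim; field.
  rewrite max_l ?subr_ge0 ?(ltW bp)//; split.
  - move=> _; rewrite plimE; split; last exact: price_cvg.
    by move=> x xA i; exact: (activation_cvg n_gt1 b_gt0 c_gt0 gamma_gt0 phat_gt0 S_nash).
  - move=> i; rewrite (_ : _ * _ = gamma * (phat - b) / (gamma + sigma) / c i).
      exact: quantity_cvg.
    by field; rewrite gs_neq0 c_neq0.
  - move=> i; rewrite (_ : _ * _ = (gamma * (phat - b) / (gamma + sigma)) ^+ 2 / (2 * c i)).
      exact: utility_cvg.
    by field; rewrite gs_neq0 c_neq0.
have ev (f : R -> R) a : (forall K, 0 < K -> f K = a) -> f K @[K --> +oo] --> a.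
  move=> fE; apply: cvg_near_cst; near=> K; apply: fE.
  by near: K; exact: nbhs_pinfty_gt.
rewrite max_r ?subr_le0//; split.
- move=> bp; have -> : plim = phat.
    by rewrite /plim (_ : b = phat); [field|apply/eqP; rewrite eq_le bp].
  split; last by apply: ev => K K0; exact: (no_trade_price c_gt0 gamma_gt0 phat_gt0 S_nash).
  by move=> x xA i; apply: ev => K K0;
    apply: (no_trade_activation c_gt0 gamma_gt0 phat_gt0 S_nash)
    (xA K K0).
- by move=> i; rewrite mulr0; apply: ev => K K0;
  case: (no_trade c_gt0 gamma_gt0 phat_gt0 S_nash i pb K0).
- by move=> i; rewrite expr0n mulr0; apply: ev => K K0;
  case: (no_trade c_gt0 gamma_gt0 phat_gt0 S_nash i pb K0).
Unshelve. all: by end_near. Qed.
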